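(* Let $P$ be a set of (non-empty) permutations and $n\ge0$. Then the staircase encoding $\mathrm{SE}$ is a bijection between $\mathrm{Av}^{(n)}(2413,3142,2314,3124,1\oplus P)$ and $\mathrm{WI}(\mathcal{UDRC}(B_n),\mathrm{Av}^{+}(2413,3142,2314,3124,P))$.
   Context: A permutation of size $n$ is a word containing each of $1,\dots,n$ exactly once. $\sigma$ contains $\pi$ if some subsequence of $\sigma$ has the same relative order as $\pi$; otherwise it avoids $\pi$. $\mathrm{Av}(P)$ is the set of permutations avoiding every element of $P$, $\mathrm{Av}^{+}(P)$ its non-empty elements. $1\oplus\pi$ is the permutation $1(\pi_1+1)\cdots(\pi_m+1)$ and $1\oplus P=\{1\oplus\pi:\pi\in P\}$. The empty permutation is not in $P$. A left-to-right minimum of $\sigma$ is an entry $\sigma_i$ with $\sigma_j>\sigma_i$ for all $j<i$; $\mathrm{Av}^{(n)}(Q)$ is the set of permutations in $\mathrm{Av}(Q)$ with exactly $n$ left-to-right minima. $B_n=\{(i,j):1\le i\le j\le n\}$ (row $i$, column $j$, row 1 on top). If $\sigma$ has left-to-right minima at positions $p_1<\dots<p_n$ with values $v_1>\dots>v_n$, each non-minimum entry $\sigma_k$ lies in cell $(i,j)$ where $j$ is the largest index with $p_j<k$ and $i$ the smallest index with $v_i<\sigma_k$. $\mathrm{SE}(\sigma)$ is the filling of $B_n$ putting in each cell the standardization of the entries of $\sigma$ in that cell (empty permutation if none). $\mathcal{UDRC}(B_n)$ is the graph on $B_n$ in which $(i,j)\ne(k,\ell)$ are adjacent iff at least one of: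 (up) $i>k$ and $j<\ell$ (or symmetrically); (down) $i<k$, $j<\ell$ and $\{i,\dots,k\}\times\{j,\dots,\ell\}\subseteq B_n$ (or symmetrically); (row) $i=k$; (column) $j=\ell$. For a graph $G$ on $B_n$ and a set $S$ of non-empty permutations, $\mathrm{WI}(G,S)$ is the set of fillings of $B_n$ whose non-empty cells form an independent set of $G$ and all contain elements of $S$. ''SE is a bijection between $X$ and $Y$'' means SE restricted to $X$ is injective with image exactly $Y$. *)

(* Defs.v *)
From HB Require Import structures.
From mathcomp Require Export all_boot.
From mathcomp Require Export boolp classical_sets functions.

Set Implicit Arguments.
Unset Strict Implicit.
Unset Printing Implicit Defensive.

Definition is_permutation (s : seq nat) : bool := perm_eq s (iota 1 (size s)).

Definition same_relative_order (s t : seq nat) : Prop :=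
  size s = size t /\
  forall a b, a < size s -> b < size s ->
    (nth 0 s a < nth 0 s b) = (nth 0 t a < nth 0 t b).

Definition contains (s p : seq nat) : Prop :=
  exists2 t, subseq t s & same_relative_order t p.

Definition Av (Q : set (seq nat)) : set (seq nat) :=
  fun s => is_permutation s /\ forall q, Q q -> ~ contains s q.

Definition Avplus (Q : set (seq nat)) : set (seq nat) :=
  fun s => Av Q s /\ s <> [::].

Definition oplus1 (p : seq nat) : seq nat := 1 :: [seq x.+1 | x <- p].

(* Positions in a word are 0-based. *)
Definition is_lrmin (s : seq nat) (k : nat) : bool :=
  all (fun y => nth 0 s k < y) (take k s).

Definition lrmin_positions (s : seq nat) : seq nat :=
  [seq k <- iota 0 (size s) | is_lrmin s k].

Definition Av_lrmin (n : nat) (Q : set (seq nat)) : set (seq nat) :=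
  fun s => Av Q s /\ size (lrmin_positions s) = n.

(* The cell (i, j), 1 <= i <= j <= n, is encoded as (i - 1, j - 1). *)
Definition in_staircase (n : nat) (c : 'I_n * 'I_n) : bool := c.1 <= c.2.

Definition cell (n : nat) := {c : 'I_n * 'I_n | in_staircase c}.

Definition cell_row (n : nat) (c : cell n) : 'I_n := (val c).1.
Definition cell_col (n : nat) (c : cell n) : 'I_n := (val c).2.

(* Non-empty cells of the fillings in [WI] hold elements of a set of
   permutations, so the values of a filling need not be constrained here. *)
Definition filling (n : nat) := {ffun cell n -> seq nat}.

Definition standardization (s : seq nat) : seq nat :=
  [seq count (fun y => y <= x) s | x <- s].

Definition lrmin_pos (s : seq nat) (j : nat) : nat :=
  nth 0 (lrmin_positions s) j.
Definition lrmin_val (s : seq nat) (i : nat) : nat := nth 0 s (lrmin_pos s i).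

(* Meaningful when s has exactly n left-to-right minima. *)
Definition lies_in_cell (n : nat) (s : seq nat) (k : nat) (c : cell n) : bool :=
  [&& ~~ is_lrmin s k,
      lrmin_pos s (cell_col c) < k,
      [forall j : 'I_n, (lrmin_pos s j < k) ==> (j <= cell_col c)],
      lrmin_val s (cell_row c) < nth 0 s k
    & [forall i : 'I_n, (lrmin_val s i < nth 0 s k) ==> (cell_row c <= i)]].

Definition SE (n : nat) (s : seq nat) : filling n :=
  [ffun c : cell n =>
     standardization
       [seq nth 0 s k | k <- iota 0 (size s) & lies_in_cell s k c]].

Definition up_edge (n : nat) (c d : cell n) : bool :=
  (cell_row d < cell_row c) && (cell_col c < cell_col d).

Definition down_edge (n : nat) (c d : cell n) : bool :=
  [&& cell_row c < cell_row d,
      cell_col c < cell_col d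
    & [forall a : 'I_n, forall b : 'I_n,
         (cell_row c <= a <= cell_row d) && (cell_col c <= b <= cell_col d)
         ==> in_staircase (a, b)]].

Definition UDRC (n : nat) : rel (cell n) := fun c d =>
  (c != d) &&
  [|| up_edge c d || up_edge d c,
      down_edge c d || down_edge d c,
      cell_row c == cell_row d
    | cell_col c == cell_col d].

Definition WI (n : nat) (G : rel (cell n)) (S : set (seq nat)) :
    set (filling n) := fun f =>
  (forall c d, f c <> [::] -> f d <> [::] -> ~~ G c d) /\
  (forall c, f c <> [::] -> S (f c)).

(* Main.v *)
From mathcomp Require Import zify.
Require Import Defs.

Set Implicit Arguments.
Unset Strict Implicit.
Unset Printing Implicit Defensive.

(** Identify the cell (i, j) of the staircase with the interval [i, j]; then two
    distinct cells are adjacent in UDRC iff their intervals meet.  If two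
    entries in distinct cells have intervals meeting, the minima that bound the
    cells complete them to one of the four patterns, so an avoider has pairwise
    disjoint occupied cells.  Conversely, when the occupied cells are disjoint,
    two entries with a common entry below and to the left of both share a cell,
    and so does every entry lying between two entries of a cell in position or
    in value.  Hence an occurrence of one of the four patterns, or of the part
    above the 1 of a pattern in 1 (+) P, lies inside a single cell.  Disjointness
    leaves at most one occupied cell in each row and column, which determines
    the word up to relative order from its filling. *)

(** * Relative order and standardization *)

Lemma same_relative_order_sym (s t : seq nat) :
  same_relative_order s t -> same_relative_order t s.
Proof. by case=> ssz h; split=> // a b; rewrite -ssz => ha hb; rewrite h. Qed.

Lemma same_relative_order_trans (s t u : seq nat) :
  same_relative_order s t -> same_relative_order t u ->
  same_relative_order s u.
Proof.
case=> st hst [tu htu]; split; first by rewrite st.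
by move=> a b ha hb; rewrite hst // htu -?st.
Qed.

Lemma same_relative_order_map (T : eqType) (g h : T -> nat) (ks : seq T) :
  {in ks &, forall k l, (g k < g l) = (h k < h l)} ->
  same_relative_order (map g ks) (map h ks).
Proof.
move=> H; split; first by rewrite !size_map.
rewrite size_map; case: ks H => // x ks H a b ha hb.
by rewrite !(nth_map x) // H // mem_nth.
Qed.

Lemma same_relative_order_nth (s t : seq nat) (ks : seq nat) :
  same_relative_order s t -> {subset ks <= iota 0 (size s)} ->
  same_relative_order (map (nth 0 s) ks) (map (nth 0 t) ks).
Proof.
case=> _ H sub; apply: same_relative_order_map => k l /sub + /sub.
by rewrite !mem_iota /= !add0n => hk hl; apply: H.
Qed.

(** When [x < y], the two counts differ by the number of entries above [x] and at most [y], and [y]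
    itself is one of these. *)
Lemma count_leq_mono (s : seq nat) x y :
  y \in s -> (count (leq^~ x) s < count (leq^~ y) s) = (x < y).
Proof.
move=> ys; case: (ltnP x y) => xy; last first.
  by apply/negbTE; rewrite -leqNgt; apply: sub_count => z /= zy; lia.
have -> : count (leq^~ y) s = count (leq^~ x) s + count (fun z => x < z <= y) s.
  by elim: s {ys} => //= z s; lia.
rewrite -[X in X < _]addn0 ltn_add2l -has_count; apply/hasP.
by exists y => //; lia.
Qed.

Lemma standardization_order (s : seq nat) : same_relative_order s (standardization s).
Proof.
rewrite -{1}[s]map_id; apply: same_relative_order_map => x y _ ys.
by rewrite count_leq_mono.
Qed.

Lemma standardization_ext (s t : seq nat) :
  same_relative_order s t -> standardization s = standardization t.
Proof.
move=> [sz H]; apply: (@eq_from_nth _ 0); first by rewrite !size_map.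
move=> i; rewrite size_map => hi; rewrite !(nth_map 0) -?sz //.
(* Reading both words through their indices turns the two counts into counts over one list of
   positions. *)
rewrite -{2}[s](mkseq_nth 0) -{2}[t](mkseq_nth 0) -sz !count_map.
apply: eq_in_count => k; rewrite mem_iota /= add0n => hk.
by rewrite [LHS]leqNgt [RHS]leqNgt H.
Qed.

Lemma standardization_permutation (s : seq nat) :
  uniq s -> is_permutation (standardization s).
Proof.
move=> us; rewrite /is_permutation.
have ust : uniq (standardization s).
  rewrite map_inj_in_uniq // => x y xs ys e.
  by move: (count_leq_mono y xs) (count_leq_mono x ys); rewrite e !ltnn; lia.
apply: uniq_perm; rewrite ?iota_uniq //.
(* Pigeonhole: [size s] distinct values inside the range from 1 to [size s] fill it. *)
apply: (uniq_min_size ust _ _).2; last by rewrite size_iota.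
move=> _ /mapP[x xs ->]; rewrite mem_iota size_map add1n ltnS count_size andbT.
by rewrite -has_count; apply/hasP; exists x.
Qed.

Lemma permutation_uniq (s : seq nat) : is_permutation s -> uniq s.
Proof. by move/perm_uniq ->; rewrite iota_uniq. Qed.

Lemma count_leq_iota m N : m <= N -> count (leq^~ m) (iota 1 N) = m.
Proof.
move=> mN; rewrite -(subnKC mN) iotaD count_cat add1n.
have -> : count (leq^~ m) (iota m.+1 (N - m)) = 0.
  by apply/eqP; rewrite -leqn0 leqNgt -has_count; apply/hasPn => z;
     rewrite mem_iota /=; lia.
rewrite addn0 -[RHS](size_iota 1 m); apply/eqP; rewrite -all_count.
by apply/allP => z; rewrite mem_iota /=; lia.
Qed.

Lemma standardization_id (s : seq nat) : is_permutation s -> standardization s = s.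
Proof.
move=> ps; rewrite -[RHS]map_id; apply/eq_in_map => x xs.
rewrite (seq.permP ps); apply: count_leq_iota.
by move: xs; rewrite (perm_mem ps) mem_iota; lia.
Qed.

(** * Occurrences of patterns *)

(** Occurrences are recorded by positions rather than values, because rows, columns and minimality
    are attributes of positions. *)
Lemma containsP (s : seq nat) q :
  contains s q <->
  exists2 ks, subseq ks (iota 0 (size s)) &
              same_relative_order [seq nth 0 s k | k <- ks] q.
Proof.
split=> [[t /subseqP[m sm ->] o] | [ks sub o]].
  exists (mask m (iota 0 (size s))); first exact: mask_subseq.
  by rewrite map_mask map_nth_iota0 // take_size.
exists [seq nth 0 s k | k <- ks] => //.
by rewrite -{2}[s](mkseq_nth 0); apply: map_subseq.
Qed.

Lemma contains_order (s t : seq nat) q :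
  same_relative_order s t -> contains s q -> contains t q.
Proof.
move=> st /containsP[ks sub o]; apply/containsP.
exists ks; first by case: st => <-.
apply: same_relative_order_trans o; apply/same_relative_order_sym.
by apply: same_relative_order_nth => // k /(mem_subseq sub).
Qed.

Lemma contains_order_iff (s t : seq nat) q :
  same_relative_order s t -> contains s q <-> contains t q.
Proof.
by move=> st; split; apply: contains_order => //; apply: same_relative_order_sym.
Qed.

Lemma contains_subseq (s t : seq nat) q : subseq s t -> contains s q -> contains t q.
Proof. by move=> st [u us o]; exists u => //; apply: subseq_trans us st. Qed.

Lemma sorted_subseq_iota ks N :
  sorted ltn ks -> all (gtn N) ks -> subseq ks (iota 0 N).
Proof.
move=> srt lt; have -> : ks = [seq k <- iota 0 N | k \in ks].
  apply: (irr_sorted_eq ltn_trans ltnn) => //.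
    exact/(sorted_filter ltn_trans)/iota_ltn_sorted.
  move=> k; rewrite mem_filter mem_iota /= add0n.
  by case: (boolP (k \in ks)) => //= /(allP lt).
exact: filter_subseq.
Qed.

Lemma contains4P (s : seq nat) a b c d :
  contains s [:: a; b; c; d] <->
  exists w x y z, [/\ w < x, x < y, y < z, z < size s &
    same_relative_order [:: nth 0 s w; nth 0 s x; nth 0 s y; nth 0 s z]
                        [:: a; b; c; d]].
Proof.
rewrite containsP; split.
  case=> ks sub o; have sz := o.1; rewrite size_map in sz.
  case: ks sz sub o => [|w [|x [|y [|z [|? ?]]]]] //= _ sub o.
  have srt : sorted ltn [:: w; x; y; z].
    by apply: (subseq_sorted ltn_trans sub); apply: iota_ltn_sorted.
  move: srt => /= /and4P[wx xy yz _]; exists w, x, y, z; split=> //.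
  have /(mem_subseq sub) : z \in [:: w; x; y; z] by rewrite !inE eqxx !orbT.
  by rewrite mem_iota.
case=> w [x [y [z [wx xy yz zs o]]]]; exists [:: w; x; y; z] => //.
apply: sorted_subseq_iota; first by rewrite /= wx xy yz.
by rewrite /=; lia.
Qed.

(** One comparison for each ordered pair of distinct positions, a form that [lia] can decide. *)
Lemma order4P w x y z a b c d :
  same_relative_order [:: w; x; y; z] [:: a; b; c; d] <->
  [&& [&& (w < x) == (a < b), (x < w) == (b < a), (w < y) == (a < c)
        & (y < w) == (c < a)],
      [&& (w < z) == (a < d), (z < w) == (d < a), (x < y) == (b < c)
        & (y < x) == (c < b)]
    & [&& (x < z) == (b < d), (z < x) == (d < b), (y < z) == (c < d)
        & (z < y) == (d < c)]].
Proof.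
split=> [[_ o] | h].
  have e i j : i < 4 -> j < 4 -> _ := fun hi hj => introT eqP (o i j hi hj).
  by rewrite (e 0 1) ?(e 1 0) ?(e 0 2) ?(e 2 0) ?(e 0 3) ?(e 3 0) ?(e 1 2)
    ?(e 2 1) ?(e 1 3) ?(e 3 1) ?(e 2 3) ?(e 3 2).
case/and3P: h => /and4P[/eqP ? /eqP ? /eqP ? /eqP ?].
move=> /and4P[/eqP ? /eqP ? /eqP ? /eqP ?] /and4P[/eqP ? /eqP ? /eqP ? /eqP ?].
by split=> // - [|[|[|[|?]]]] [|[|[|[|?]]]] //= _ _; rewrite !ltnn.
Qed.

(** The chain runs through the four entries by increasing value; the same holds for the three
    patterns below. *)
Lemma order2413 w x y z :
  same_relative_order [:: w; x; y; z] [:: 2; 4; 1; 3] <->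
  [&& y < w, w < z & z < x].
Proof. by rewrite order4P; split; lia. Qed.

Lemma order3142 w x y z :
  same_relative_order [:: w; x; y; z] [:: 3; 1; 4; 2] <->
  [&& x < z, z < w & w < y].
Proof. by rewrite order4P; split; lia. Qed.

Lemma order2314 w x y z :
  same_relative_order [:: w; x; y; z] [:: 2; 3; 1; 4] <->
  [&& y < w, w < x & x < z].
Proof. by rewrite order4P; split; lia. Qed.

Lemma order3124 w x y z :
  same_relative_order [:: w; x; y; z] [:: 3; 1; 2; 4] <->
  [&& x < y, y < w & w < z].
Proof. by rewrite order4P; split; lia. Qed.

(** * Row and column of an entry *)

(* Both are 0-based, and the m-th left-to-right minimum gets row and column m. *)
Definition col_index (s : seq nat) (k : nat) : nat :=
  (count (leq^~ k) (lrmin_positions s)).-1.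
Definition row_index (s : seq nat) (k : nat) : nat :=
  count (fun p => nth 0 s k < nth 0 s p) (lrmin_positions s).

(** A predicate inherited by earlier elements holds exactly on a prefix, whose length is its count.
    This turns the counts that define rows and columns into comparisons with a single minimum. *)
Lemma ltn_count_prefix (a : pred nat) (l : seq nat) j :
  pairwise (fun x y => a y ==> a x) l -> j < size l ->
  (j < count a l) = a (nth 0 l j).
Proof.
elim: l j => //= x l IH j /andP[/allP ax /IH{}IH].
case: (boolP (a x)) ax => [ax _ | nax ax].
  by case: j => [|j] //= hj; rewrite ?add1n ?ltnS ?IH //; rewrite ax.
have na y : y \in l -> a y = false by move/ax; case: (a y) => //.
rewrite (eq_in_count (a2 := pred0)) ?count_pred0; last exact: na.
case: j => [|j] /= hj; first by rewrite (negbTE nax).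
by rewrite na // mem_nth.
Qed.

Lemma is_lrminE s k :
  k <= size s ->
  is_lrmin s k = all (fun i => nth 0 s k < nth 0 s i) (iota 0 k).
Proof. by move=> ks; rewrite /is_lrmin -(map_nth_iota0 0 ks) all_map. Qed.

Section RowsAndColumns.
Variables (s : seq nat).
Local Notation mins := (lrmin_positions s).
Local Notation n := (size mins).
Local Notation p := (lrmin_pos s).
Local Notation v := (lrmin_val s).
Local Notation val k := (nth 0 s k).

Lemma lrmin_positions_sorted : sorted ltn mins.
Proof. exact/(sorted_filter ltn_trans)/iota_ltn_sorted. Qed.

Lemma mem_lrmin_positions k : (k \in mins) = is_lrmin s k && (k < size s).
Proof. by rewrite mem_filter mem_iota. Qed.

Lemma lrmin_pos_mem j : j < n -> is_lrmin s (p j) /\ p j < size s.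
Proof. by move/(mem_nth 0); rewrite mem_lrmin_positions => /andP[]. Qed.

Lemma lrmin_lt k l :
  is_lrmin s k -> l < k -> k < size s -> val k < val l.
Proof.
move=> hk lk ks; move: hk; rewrite is_lrminE; last exact: ltnW.
by move/allP; apply; rewrite mem_iota.
Qed.

(** The minima at positions up to [k] form a prefix of the list. *)
Lemma leq_lrmin_pos k j : k < size s -> j < n -> (p j <= k) = (j <= col_index s k).
Proof.
move=> ks jn; rewrite -(@ltn_count_prefix (leq^~ k) mins) //; last first.
  have := lrmin_positions_sorted; rewrite (sorted_pairwise ltn_trans).
  by apply: sub_pairwise => x y; rewrite /=; lia.
(* Position 0 always holds a minimum, so the predecessor in [col_index] does not truncate. *)
rewrite /col_index; suff : 0 < count (leq^~ k) mins by lia.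
rewrite -has_count; apply/hasP; exists 0 => //.
by rewrite mem_lrmin_positions /is_lrmin take0 /=; lia.
Qed.

(** The values of the minima decrease along the list, so those above [val k] form a prefix. *)
Lemma leq_lrmin_val k j : j < n -> (v j <= val k) = (row_index s k <= j).
Proof.
move=> jn; rewrite leqNgt [RHS]leqNgt; congr (~~ _).
rewrite -(@ltn_count_prefix (fun q => val k < val q) mins) //.
have := lrmin_positions_sorted; rewrite (sorted_pairwise ltn_trans).
apply: (@sub_in_pairwise _ (mem mins)); last exact/allP.
move=> x y; rewrite /= !mem_lrmin_positions => /andP[_ xs] /andP[my ys] xy.
by apply/implyP; have := lrmin_lt my xy ys; lia.
Qed.

Lemma col_index_lt k : k < size s -> col_index s k < n.
Proof.
move=> ks; rewrite /col_index; have := count_size (leq^~ k) mins.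
have : 0 < n; last by lia.
rewrite -(@count_predT _ mins) -has_count; apply/hasP; exists 0 => //.
by rewrite mem_lrmin_positions /is_lrmin take0 /=; lia.
Qed.

Lemma lrmin_pos_lt i j : i < j -> j < n -> p i < p j.
Proof.
move=> ij jn; apply: (sorted_ltn_nth ltn_trans) => //.
- exact: lrmin_positions_sorted.
- by rewrite inE (ltn_trans ij).
Qed.

Lemma lrmin_val_lt i j : i < j -> j < n -> v j < v i.
Proof.
move=> ij jn; have [mj js] := lrmin_pos_mem jn.
by apply: lrmin_lt => //; apply: lrmin_pos_lt.
Qed.

Lemma col_index_lrmin_pos j : j < n -> col_index s (p j) = j.
Proof.
move=> jn; have [_ js] := lrmin_pos_mem jn; have cn := col_index_lt js.
have := leq_lrmin_pos js jn; rewrite leqnn => /esym h1.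
have := leq_lrmin_pos js cn; rewrite leqnn => h2.
by case: (ltngtP (col_index s (p j)) j) => // h; have := lrmin_pos_lt h; lia.
Qed.

Lemma lrmin_pos_col_index k :
  k < size s -> is_lrmin s k -> p (col_index s k) = k.
Proof.
move=> ks mk; have km : k \in mins by rewrite mem_lrmin_positions mk.
have e : p (index k mins) = k by rewrite /lrmin_pos nth_index.
by rewrite -{1}e col_index_lrmin_pos ?index_mem.
Qed.

Lemma row_index_lrmin_pos j : j < n -> row_index s (p j) = j.
Proof.
move=> jn; have [_ js] := lrmin_pos_mem jn.
have := leq_lrmin_val (p j) jn; rewrite leqnn => /esym h1.
have rn : row_index s (p j) < n by lia.
have := leq_lrmin_val (p j) rn; rewrite leqnn => h2.
case: (ltngtP (row_index s (p j)) j) => // h; last by lia.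
by have := lrmin_val_lt h jn; rewrite /lrmin_val in h2 *; lia.
Qed.

Lemma row_index_lrmin k :
  k < size s -> is_lrmin s k -> row_index s k = col_index s k.
Proof.
move=> ks mk; rewrite -{1}(lrmin_pos_col_index ks mk) row_index_lrmin_pos //.
exact: col_index_lt.
Qed.

(** The minimum opening the column of an entry is at most that entry. For a non-minimum some earlier
    entry is no larger; by induction the minimum opening the column of that one is below it, and
    later minima are lower still. *)
Lemma leq_row_index_col_index k : k < size s -> row_index s k <= col_index s k.
Proof.
have [m] := ubnP k; elim: m k => // m IH k km ks.
case: (boolP (is_lrmin s k)) => [mk | ]; first by rewrite row_index_lrmin.
rewrite is_lrminE; last exact: ltnW.
case/allPn => l; rewrite mem_iota /= add0n -leqNgt => lk vlk.
have ls : l < size s by apply: ltn_trans ks.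
have := IH l (leq_trans lk km) ls; have cl := col_index_lt ls.
rewrite -leq_lrmin_val // => h; rewrite -(leq_lrmin_val _ (col_index_lt ks)).
have : p (col_index s l) <= k.
  by apply: leq_trans (ltnW lk); rewrite leq_lrmin_pos.
rewrite leq_lrmin_pos // leq_eqVlt => /orP[/eqP <- | /lrmin_val_lt].
  exact: leq_trans vlk.
by move/(_ (col_index_lt ks)); lia.
Qed.

Lemma row_index_lt k : k < size s -> row_index s k < n.
Proof.
by move=> ks; apply: leq_ltn_trans (col_index_lt ks); exact: leq_row_index_col_index.
Qed.

Lemma leq_col_index k l : k <= l -> l < size s -> col_index s k <= col_index s l.
Proof.
move=> kl ls; have ks := leq_ltn_trans kl ls.
rewrite -leq_lrmin_pos ?col_index_lt //; apply: leq_trans kl.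
by rewrite leq_lrmin_pos ?col_index_lt.
Qed.

Lemma leq_row_index k l :
  k < size s -> l < size s -> val k <= val l -> row_index s l <= row_index s k.
Proof.
move=> ks ls kl; rewrite -leq_lrmin_val ?row_index_lt //.
by apply: leq_trans kl; rewrite leq_lrmin_val ?row_index_lt.
Qed.

(** [lies_in_cell] compares strictly; a non-minimum never coincides with a minimum, so the weak
    comparison can be sharpened. *)
Lemma lrmin_pos_lt_nonmin k j :
  k < size s -> ~~ is_lrmin s k -> j < n -> (p j < k) = (j <= col_index s k).
Proof.
move=> ks mk jn; rewrite -leq_lrmin_pos // ltn_neqAle; case: eqP => // e.
by have [] := lrmin_pos_mem jn; rewrite e (negbTE mk).
Qed.

Lemma lrmin_val_lt_nonmin k j :
  uniq s -> k < size s -> ~~ is_lrmin s k -> j < n ->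
  (v j < val k) = (row_index s k <= j).
Proof.
move=> us ks mk jn; rewrite -leq_lrmin_val // ltn_neqAle; case: eqP => // e.
have [mj js] := lrmin_pos_mem jn.
by move/eqP: e; rewrite nth_uniq // => /eqP e; rewrite e (negbTE mk) in mj.
Qed.

Lemma lies_in_cellE m k (c : cell m) :
  uniq s -> n = m -> k < size s ->
  lies_in_cell s k c = [&& ~~ is_lrmin s k, row_index s k == cell_row c
                         & col_index s k == cell_col c].
Proof.
move=> us nm ks; rewrite /lies_in_cell.
case: (boolP (is_lrmin s k)) => //= mk.
have cm := ltn_ord (cell_col c); have rm := ltn_ord (cell_row c).
have kcn := col_index_lt ks; have krn := row_index_lt ks.
rewrite lrmin_pos_lt_nonmin ?lrmin_val_lt_nonmin ?nm //.
apply/and4P/andP=> [[h1 /forallP h2 h3 /forallP h4] | [/eqP h1 /eqP h2]].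
  rewrite nm in kcn krn.
  (* The universal conditions, applied to the indices of [k] itself, give the inequalities opposite
     to [h1] and [h3]. *)
  have := h2 (Ordinal kcn); rewrite /= lrmin_pos_lt_nonmin ?nm // leqnn /= => h5.
  have := h4 (Ordinal krn); rewrite /= lrmin_val_lt_nonmin ?nm // leqnn /= => h6.
  by rewrite !eqn_leq h1 h3 h5 h6.
rewrite h1 h2 !leqnn; split=> //; apply/forallP => j; apply/implyP.
  by rewrite lrmin_pos_lt_nonmin ?nm // h2.
by rewrite lrmin_val_lt_nonmin ?nm // h1.
Qed.

End RowsAndColumns.

(** * Avoidance and disjointness of the occupied cells *)

(** For the intervals from row to column, an up edge is strict nesting, a down edge a proper
    overlap, and a row or column edge a shared endpoint; together these are all the ways in which
    two distinct intervals meet. *)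
Lemma UDRCE n (c d : cell n) :
  UDRC c d =
  [&& c != d, cell_row c <= cell_col d & cell_row d <= cell_col c].
Proof.
rewrite /UDRC; case: (eqVneq c d) => //= cd.
have hc : cell_row c <= cell_col c := valP c.
have hd : cell_row d <= cell_col d := valP d.
have downE (a b : cell n) : down_edge a b =
    [&& cell_row a < cell_row b, cell_col a < cell_col b
      & cell_row b <= cell_col a].
  rewrite /down_edge; case: (ltnP (cell_row a) (cell_row b)) => //= rab.
  case: (ltnP (cell_col a) (cell_col b)) => //= cab.
  apply/forallP/idP => [h | h x].
    (* The lower-left corner of the rectangle is its extreme cell: it lies in the staircase iff the
       whole rectangle does. *)
    have /forallP/(_ (cell_col a)) := h (cell_row b).
    by rewrite !leqnn (ltnW rab) (ltnW cab).
  by apply/forallP => y; apply/implyP; rewrite /in_staircase /=; lia.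
(* Distinctness of the cells, restated on coordinates for the closing [lia]. *)
have : (cell_row c == cell_row d) && (cell_col c == cell_col d) = false.
  apply/negbTE/negP => /andP[/eqP e1 /eqP e2]; case/eqP: cd; apply: val_inj.
  by apply/eqP; rewrite -[_ == _]/((_ == _) && (_ == _)); apply/andP; split;
    apply/eqP.
rewrite !downE /up_edge -!val_eqE /=; lia.
Qed.

(** Only indices are compared: a minimum also has a row and a column, so non-minimality is tracked
    separately. *)
Definition same_cell (s : seq nat) k l :=
  row_index s k = row_index s l /\ col_index s k = col_index s l.

Definition disjoint_cells (s : seq nat) : Prop :=
  forall k l, k < size s -> l < size s ->
  ~~ is_lrmin s k -> ~~ is_lrmin s l ->
  row_index s k <= col_index s l -> row_index s l <= col_index s k ->
  same_cell s k l.

Definition avoids_basis4 (s : seq nat) : Prop :=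
  [/\ ~ contains s [:: 2; 4; 1; 3], ~ contains s [:: 3; 1; 4; 2],
      ~ contains s [:: 2; 3; 1; 4] & ~ contains s [:: 3; 1; 2; 4]].

(** Take [k < l] with meeting intervals. If the columns differ, the minimum opening the column of
    [l] separates them, and an earlier minimum below both completes a 2314 or a 2413. If only the
    rows differ, two consecutive minima before both, around the lower entry in value, complete a
    3142 or a 3124. *)
Lemma avoids_basis4_disjoint (s : seq nat) :
  uniq s -> avoids_basis4 s -> disjoint_cells s.
Proof.
move=> us [n2413 n3142 n2314 n3124].
suff W k l : k < l -> l < size s -> ~~ is_lrmin s k -> ~~ is_lrmin s l ->
    row_index s k <= col_index s l -> row_index s l <= col_index s k ->
    same_cell s k l.
  move=> k l ks ls mk ml h1 h2; case: (ltngtP k l) => [kl|lk|->] //.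
    exact: W.
  by have [] := W l k lk ks ml mk h2 h1.
move=> kl ls mk ml rkl rlk; have ks := ltn_trans kl ls.
have kcn := col_index_lt ks; have lcn := col_index_lt ls.
have krn := row_index_lt ks; have lrn := row_index_lt ls.
have nkl : nth 0 s k != nth 0 s l by rewrite nth_uniq //; lia.
have rk := leq_row_index_col_index ks.
have ccl : col_index s k = col_index s l.
  apply/eqP; rewrite eqn_leq leq_col_index ?(ltnW kl) //= leqNgt; apply/negP.
  (* A row is the first minimum below an entry, so [t] is the first minimum below both; meeting
     intervals put it to the left of [k]. *)
  move=> cc; set t := maxn (row_index s k) (row_index s l).
  have tk : t <= col_index s k by rewrite geq_max rk.
  have tn : t < size (lrmin_positions s) by apply: leq_ltn_trans kcn.
  have h1 : lrmin_pos s t < k by rewrite lrmin_pos_lt_nonmin.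
  have h2 : k < lrmin_pos s (col_index s l).
    by rewrite ltnNge leq_lrmin_pos // -ltnNge.
  have h3 : lrmin_pos s (col_index s l) < l by rewrite lrmin_pos_lt_nonmin.
  have h4 : lrmin_val s (col_index s l) < lrmin_val s t.
    by apply: lrmin_val_lt => //; apply: leq_ltn_trans cc.
  have h5 : lrmin_val s t < nth 0 s k.
    by rewrite lrmin_val_lt_nonmin // leq_maxl.
  have h6 : lrmin_val s t < nth 0 s l.
    by rewrite lrmin_val_lt_nonmin // leq_maxr.
  rewrite /lrmin_val in h4 h5 h6; case: (ltngtP (nth 0 s k) (nth 0 s l)) => h.
  - apply: n2314; apply/contains4P.
    exists (lrmin_pos s t), k, (lrmin_pos s (col_index s l)), l.
    by split=> //; apply/order2314/and3P.
  - apply: n2413; apply/contains4P.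
    exists (lrmin_pos s t), k, (lrmin_pos s (col_index s l)), l.
    by split=> //; apply/order2413/and3P.
  - by rewrite h eqxx in nkl.
(* Here [x] names the entry of the upper row and [y] that of the lower row; their order in position
   decides the pattern. *)
suff B x y : x < size s -> y < size s -> ~~ is_lrmin s x -> ~~ is_lrmin s y ->
    row_index s x < row_index s y -> row_index s y <= col_index s k ->
    (x = k /\ y = l) \/ (x = l /\ y = k) -> False.
  split=> //; case: (ltngtP (row_index s k) (row_index s l)) => // h; exfalso.
    by apply: (B k l) => //; left.
  by apply: (B l k) => //; right.
move=> xs ys mx my rxy ryk xy.
have yrn := row_index_lt ys.
(* The row of [y] is not the first, so [y] lies in value between the consecutive minima [r.+1] and
   [r], while [x] exceeds both. *)
case E : (row_index s y) rxy => [|r] // rxr; rewrite ltnS in rxr.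
rewrite E in yrn ryk; have rn := ltnW yrn.
have h1 : lrmin_pos s r < lrmin_pos s r.+1 by apply: lrmin_pos_lt.
have h2 : lrmin_pos s r.+1 < k by rewrite lrmin_pos_lt_nonmin.
have h3 : lrmin_val s r.+1 < nth 0 s y by rewrite lrmin_val_lt_nonmin // E.
have h4 : nth 0 s y < lrmin_val s r by rewrite ltnNge leq_lrmin_val // E -ltnNge.
have h5 : lrmin_val s r < nth 0 s x by rewrite lrmin_val_lt_nonmin.
rewrite /lrmin_val in h3 h4 h5.
case: xy => [[e1 e2]|[e1 e2]]; subst x y.
- apply: n3142; apply/contains4P; exists (lrmin_pos s r), (lrmin_pos s r.+1), k, l.
  by split=> //; apply/order3142/and3P.
- apply: n3124; apply/contains4P; exists (lrmin_pos s r), (lrmin_pos s r.+1), k, l.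
  by split=> //; apply/order3124/and3P.
Qed.

(** * Cells as subwords and occurrences inside a cell *)

Definition cell_positions (s : seq nat) r c :=
  [seq k <- iota 0 (size s)
     | [&& ~~ is_lrmin s k, row_index s k == r & col_index s k == c]].

Definition cell_word (s : seq nat) r c := [seq nth 0 s k | k <- cell_positions s r c].

Lemma mem_cell_positions (s : seq nat) r c k :
  k \in cell_positions s r c =
  [&& ~~ is_lrmin s k, row_index s k == r, col_index s k == c & k < size s].
Proof. by rewrite mem_filter mem_iota /= add0n -!andbA. Qed.

Lemma cell_word_subseq (s : seq nat) r c : subseq (cell_word s r c) s.
Proof.
by rewrite -{2}[s](mkseq_nth 0); apply/map_subseq/filter_subseq.
Qed.

Lemma SE_cell_word n (s : seq nat) (c : cell n) :
  uniq s -> size (lrmin_positions s) = n ->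
  SE n s c = standardization (cell_word s (cell_row c) (cell_col c)).
Proof.
move=> us sn; rewrite ffunE; congr (standardization (map _ _)).
apply: eq_in_filter => k; rewrite mem_iota /= add0n => ks.
exact: lies_in_cellE.
Qed.

(** Standardizing preserves occurrences, so patterns of a cell can be read off the positions of
    [s]. *)
Lemma SE_contains n (s : seq nat) (c : cell n) q :
  uniq s -> size (lrmin_positions s) = n ->
  contains (SE n s c) q <->
  exists2 ks, subseq ks (cell_positions s (cell_row c) (cell_col c)) &
              same_relative_order [seq nth 0 s k | k <- ks] q.
Proof.
move=> us sn; rewrite SE_cell_word //.
rewrite -(contains_order_iff _ (standardization_order _)); split.
  case=> t /subseqP[m sz ->] o.
  exists (mask m (cell_positions s (cell_row c) (cell_col c))).
    exact: mask_subseq.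
  by rewrite map_mask.
by case=> ks sub o; exists [seq nth 0 s k | k <- ks] => //; apply: map_subseq.
Qed.

(** * Entries forced into a common cell *)

Section SharedLowerLeft.
Variable s : seq nat.
Hypothesis dis : disjoint_cells s.
Local Notation val k := (nth 0 s k).

Lemma nonmin_above x y : x < y -> y < size s -> val x < val y -> ~~ is_lrmin s y.
Proof.
by move=> xy ys vxy; apply/negP => my; have := lrmin_lt my xy ys; lia.
Qed.

(** An entry above and to the right of [x] has an interval containing that of [x]; two such
    intervals therefore meet. *)
Lemma same_cell_above x y z :
  x < y -> x < z -> y < size s -> z < size s -> val x < val y -> val x < val z ->
  same_cell s y z.
Proof.
move=> xy xz ys zs vxy vxz.
have xs := ltn_trans xy ys; have hx := leq_row_index_col_index xs.
apply: dis; rewrite ?(nonmin_above xy) ?(nonmin_above xz) //.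
  apply: leq_trans (leq_row_index xs ys (ltnW vxy)) _.
  exact: leq_trans (leq_col_index (ltnW xz) zs).
apply: leq_trans (leq_row_index xs zs (ltnW vxz)) _.
exact: leq_trans (leq_col_index (ltnW xy) ys).
Qed.

(** The columns agree by monotonicity, and intervals with a common right end meet. A column opens
    with its minimum, so nothing after [x] in that column is a minimum. *)
Lemma same_cell_between_positions x y z :
  ~~ is_lrmin s x -> x < y -> y < z -> z < size s -> same_cell s x z ->
  ~~ is_lrmin s y /\ same_cell s x y.
Proof.
move=> mx xy yz zs [rxz cxz].
have ys := ltn_trans yz zs; have xs := ltn_trans xy ys.
have cxy : col_index s x = col_index s y.
  apply/eqP; rewrite eqn_leq leq_col_index ?(ltnW xy) //= cxz.
  by rewrite leq_col_index ?(ltnW yz).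
have my : ~~ is_lrmin s y.
  apply/negP => my; have := lrmin_pos_col_index ys my.
  rewrite -cxy => e; have := leq_lrmin_pos xs (col_index_lt xs).
  by rewrite leqnn e; lia.
split=> //; apply: dis => //; rewrite -?cxy ?leq_row_index_col_index //.
by rewrite cxy leq_row_index_col_index.
Qed.

(** The same argument with rows: the left ends agree, and the minimum of a row is its smallest
    entry. *)
Lemma same_cell_between_values x y z :
  uniq s -> ~~ is_lrmin s x -> x < size s -> y < size s -> z < size s ->
  val x < val y -> val y < val z -> same_cell s x z ->
  ~~ is_lrmin s y /\ same_cell s x y.
Proof.
move=> us mx xs ys zs xy yz [rxz cxz].
have rxy : row_index s x = row_index s y.
  apply/eqP; rewrite eqn_leq [X in _ && X]leq_row_index ?(ltnW xy) // andbT rxz.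
  by rewrite leq_row_index ?(ltnW yz).
have my : ~~ is_lrmin s y.
  apply/negP => my; have := lrmin_pos_col_index ys my.
  rewrite -row_index_lrmin // -rxy => e.
  by have := leq_lrmin_val x (row_index_lt xs); rewrite leqnn /lrmin_val e; lia.
split=> //; apply: dis => //; rewrite -?rxy ?leq_row_index_col_index //.
by rewrite rxy leq_row_index_col_index.
Qed.

End SharedLowerLeft.

Lemma cell_exists n (s : seq nat) k :
  size (lrmin_positions s) = n -> k < size s ->
  exists c : cell n, cell_row c = row_index s k :> nat
                  /\ cell_col c = col_index s k :> nat.
Proof.
move=> <- ks.
have h : in_staircase (Ordinal (row_index_lt ks), Ordinal (col_index_lt ks)).
  exact: leq_row_index_col_index.
by exists (exist (fun c => in_staircase c) _ h).
Qed.

(** The position [k0] names the cell and shows that it is non-empty. *)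
Lemma SE_contains_of_same_cell n (s : seq nat) k0 ks q :
  uniq s -> size (lrmin_positions s) = n -> k0 < size s ->
  ~~ is_lrmin s k0 ->
  subseq ks (iota 0 (size s)) ->
  {in ks, forall k, ~~ is_lrmin s k /\ same_cell s k0 k} ->
  same_relative_order [seq nth 0 s k | k <- ks] q ->
  exists2 c : cell n, SE n s c <> [::] & contains (SE n s c) q.
Proof.
move=> us sn ks0 mk0 sub hks o; have [c [hr hc]] := cell_exists sn ks0.
exists c.
  rewrite SE_cell_word // => e; have : k0 \in cell_positions s (cell_row c) (cell_col c).
    by rewrite mem_cell_positions mk0 hr hc !eqxx.
  by move/(congr1 size): e; rewrite !size_map; case: cell_positions.
apply/SE_contains => //; exists ks => //.
rewrite subseq_filter sub andbT; apply/allP => k /hks[mk [rk ck]].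
by rewrite mk -rk -ck hr hc !eqxx.
Qed.

Lemma sorted4_subseq_iota w x y z N :
  w < x -> x < y -> y < z -> z < N -> subseq [:: w; x; y; z] (iota 0 N).
Proof.
move=> wx xy yz zN; apply: sorted_subseq_iota; first by rewrite /= wx xy yz.
by rewrite /=; lia.
Qed.

(** In 2413 and 2314 the 2 precedes two larger entries, which share a cell; the 1 lies between these
    in position, and then the 2 lies between the 1 and the 3 in value. In 3142 and 3124 the two
    entries after the 1 share a cell; the 3 lies between them in value, and then the 1 lies in
    position between the 3 and the entry after the 1. *)
Lemma disjoint_avoids_basis4 n (s : seq nat) :
  uniq s -> size (lrmin_positions s) = n -> disjoint_cells s ->
  (forall c, SE n s c <> [::] -> avoids_basis4 (SE n s c)) ->
  avoids_basis4 s.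
Proof.
move=> us sn dis av.
have A w x y z q : w < x -> x < y -> y < z -> z < size s ->
    same_relative_order [:: nth 0 s w; nth 0 s x; nth 0 s y; nth 0 s z] q ->
    ~~ is_lrmin s z ->
    {in [:: w; x; y; z], forall k, ~~ is_lrmin s k /\ same_cell s z k} ->
    exists2 c : cell n, SE n s c <> [::] & contains (SE n s c) q.
  move=> wx xy yz zs o mz h.
  apply: (SE_contains_of_same_cell us sn zs mz _ h) => //.
  exact: sorted4_subseq_iota.
have symc k l : same_cell s k l -> same_cell s l k by rewrite /same_cell => -[-> ->].
have trc k l m : same_cell s k l -> same_cell s l m -> same_cell s k m.
  by rewrite /same_cell => -[-> ->] [-> ->].
have mem4 w x y z (Q : nat -> Prop) : Q w -> Q x -> Q y -> Q z ->
    {in [:: w; x; y; z], forall k, Q k}.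
  by move=> ? ? ? ? k; rewrite !inE => /or4P[] /eqP ->.
split=> /contains4P[w [x [y [z [wx xy yz zs o]]]]].
- have /order2413/and3P[v1 v2 v3] := o.
  have xz : x < z by lia. have xs : x < size s by lia.
  have mx : ~~ is_lrmin s x by apply: (nonmin_above wx) => //; lia.
  have mz : ~~ is_lrmin s z by apply: (@nonmin_above _ w) => //; lia.
  have cxz : same_cell s x z by apply: (same_cell_above dis wx) => //; lia.
  have [my cxy] := same_cell_between_positions dis mx xy yz zs cxz.
  have [mw cyw] : ~~ is_lrmin s w /\ same_cell s y w.
    apply: (same_cell_between_values dis us my _ _ zs v1 v2); try lia.
    exact: trc (symc _ _ cxy) cxz.
  have [c h1 h2] : exists2 c : cell n, SE n s c <> [::] &
      contains (SE n s c) [:: 2; 4; 1; 3].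
    apply: (A w x y z) => //; apply: mem4; split=> //.
    + exact: trc (symc _ _ cxz) (trc _ _ _ cxy cyw).
    + exact: symc.
    + exact: trc (symc _ _ cxz) cxy.
  by case: (av c h1).
- have /order3142/and3P[v1 v2 v3] := o.
  have my : ~~ is_lrmin s y by apply: (nonmin_above xy) => //; lia.
  have mz : ~~ is_lrmin s z by apply: (@nonmin_above _ x) => //; lia.
  have czy : same_cell s z y.
    by apply/symc/(same_cell_above dis xy) => //; lia.
  have [mw czw] : ~~ is_lrmin s w /\ same_cell s z w.
    by apply: (same_cell_between_values dis us mz zs _ _ v2 v3 czy); lia.
  have [mx cwx] : ~~ is_lrmin s x /\ same_cell s w x.
    apply: (same_cell_between_positions dis mw wx xy); first by lia.
    exact: trc (symc _ _ czw) czy.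
  have [c h1 h2] : exists2 c : cell n, SE n s c <> [::] &
      contains (SE n s c) [:: 3; 1; 4; 2].
    apply: (A w x y z) => //; apply: mem4; split=> //.
    exact: trc czw cwx.
  by case: (av c h1).
- have /order2314/and3P[v1 v2 v3] := o.
  have mx : ~~ is_lrmin s x by apply: (nonmin_above wx) => //; lia.
  have mz : ~~ is_lrmin s z by apply: (@nonmin_above _ w) => //; lia.
  have cxz : same_cell s x z by apply: (same_cell_above dis wx) => //; lia.
  have [my cxy] := same_cell_between_positions dis mx xy yz zs cxz.
  have [mw cyw] : ~~ is_lrmin s w /\ same_cell s y w.
    apply: (same_cell_between_values dis us my _ _ _ v1 v2); try lia.
    exact: symc.
  have [c h1 h2] : exists2 c : cell n, SE n s c <> [::] &
      contains (SE n s c) [:: 2; 3; 1; 4].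
    apply: (A w x y z) => //; apply: mem4; split=> //.
    + exact: trc (symc _ _ cxz) (trc _ _ _ cxy cyw).
    + exact: symc.
    + exact: trc (symc _ _ cxz) cxy.
  by case: (av c h1).
- have /order3124/and3P[v1 v2 v3] := o.
  have my : ~~ is_lrmin s y by apply: (nonmin_above xy) => //; lia.
  have mz : ~~ is_lrmin s z by apply: (@nonmin_above _ x) => //; lia.
  have cyz : same_cell s y z.
    by apply: (same_cell_above dis xy) => //; lia.
  have [mw cyw] : ~~ is_lrmin s w /\ same_cell s y w.
    by apply: (same_cell_between_values dis us my _ _ zs v2 v3 cyz); lia.
  have [mx cwx] : ~~ is_lrmin s x /\ same_cell s w x.
    apply: (same_cell_between_positions dis mw wx xy); first by lia.
    exact: symc.
  have czw : same_cell s z w := trc _ _ _ (symc _ _ cyz) cyw.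
  have [c h1 h2] : exists2 c : cell n, SE n s c <> [::] &
      contains (SE n s c) [:: 3; 1; 2; 4].
    apply: (A w x y z) => //; apply: mem4; split=> //.
    + exact: trc czw cwx.
    + exact: symc.
  by case: (av c h1).
Qed.

(** The entry [x] playing the 1 is below and to the left of all the others, so these share the cell
    of the first of them, [k0], which exists since [p] is non-empty. *)
Lemma disjoint_avoids_oplus1 n (s : seq nat) p :
  uniq s -> size (lrmin_positions s) = n -> disjoint_cells s ->
  is_permutation p -> p <> [::] ->
  (forall c, SE n s c <> [::] -> ~ contains (SE n s c) p) ->
  ~ contains s (oplus1 p).
Proof.
move=> us sn dis pp p0 av /containsP[ks' sub o].
have sz := o.1; rewrite /= !size_map in sz.
case: ks' sz sub o => [|x ks] //= [sz] sub [_ o].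
case: ks sz sub o => [/esym/size0nil //|k0 ks] sz sub o.
have srt : sorted ltn (x :: k0 :: ks).
  by apply: (subseq_sorted ltn_trans sub); apply: iota_ltn_sorted.
move: srt; rewrite (sorted_pairwise ltn_trans) pairwise_cons.
move=> /andP[/allP lx _].
have ltN k : k \in k0 :: ks -> k < size s.
  move=> hk; have /(mem_subseq sub) : k \in x :: k0 :: ks by rewrite inE hk orbT.
  by rewrite mem_iota.
(* The entries of [p] are at least 1, so their shifts in [oplus1 p] exceed the leading 1. *)
have vx k : k \in k0 :: ks -> nth 0 s x < nth 0 s k.
  move=> hk; have hi := hk; rewrite -index_mem in hi.
  have := o 0 (index k (k0 :: ks)).+1 isT; rewrite /= !ltnS size_map => /(_ hi).
  rewrite -[_ :: map _ _]/(map (nth 0 s) (k0 :: ks)) (nth_map 0) // nth_index //.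
  move=> ->; rewrite (nth_map 0) -?sz // ltnS.
  have : nth 0 p (index k (k0 :: ks)) \in p by rewrite mem_nth // -sz.
  by rewrite (perm_mem pp) mem_iota => /andP[].
have k0in : k0 \in k0 :: ks by rewrite inE eqxx.
have [||||c h1 h2] := @SE_contains_of_same_cell n s k0 (k0 :: ks) p us sn (ltN _ k0in).
- by apply: (@nonmin_above s x) => //; [apply: lx|apply: ltN|apply: vx].
- exact: subseq_trans (subseq_cons _ _) sub.
- move=> k hk; split.
    by apply: (@nonmin_above s x) => //; [apply: lx|apply: ltN|apply: vx].
  apply: (same_cell_above dis (lx _ k0in) (lx _ hk)); by [apply: ltN|apply: vx].
- split; first by rewrite size_map.
  move=> a b; rewrite size_map => ha hb.
  have := o a.+1 b.+1; rewrite /= !ltnS size_map => /(_ ha hb).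
  by rewrite !(nth_map 0 _ succn) -?sz.
exact: (av c h1).
Qed.

(** The minimum of the row of [c] is below every entry of the cell, and to the left of it because
    the row index is at most the column index. Prepended to an occurrence of [p], it plays the 1. *)
Lemma SE_avoids_of_oplus1 n (s : seq nat) p c :
  uniq s -> size (lrmin_positions s) = n -> is_permutation p ->
  ~ contains s (oplus1 p) -> SE n s c <> [::] -> ~ contains (SE n s c) p.
Proof.
move=> us sn pp av ne /SE_contains-/(_ us sn)[ks sub o]; apply: av.
have rn : cell_row c < size (lrmin_positions s) by rewrite sn.
pose x := lrmin_pos s (cell_row c); have [_ xs] := lrmin_pos_mem rn.
have hk k : k \in ks -> [/\ x < k, k < size s & nth 0 s x < nth 0 s k].
  move/(mem_subseq sub); rewrite mem_cell_positions.
  case/and4P=> mk /eqP rk /eqP ck lk; split=> //.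
    by rewrite lrmin_pos_lt_nonmin // ck; exact: (valP c).
  by rewrite -/(lrmin_val _ _) lrmin_val_lt_nonmin // rk.
apply/containsP; exists (x :: ks).
  apply: sorted_subseq_iota.
    rewrite (sorted_pairwise ltn_trans) /= -(sorted_pairwise ltn_trans).
    apply/andP; split; first by apply/allP => k /hk[].
    apply: (subseq_sorted ltn_trans sub).
    exact/(sorted_filter ltn_trans)/iota_ltn_sorted.
  by rewrite /= xs; apply/allP => k /hk[].
case: o => sz o; rewrite size_map in sz o.
split; first by rewrite /= !size_map sz.
have pos a : a < size ks -> 0 < nth 0 p a.
  move=> ha; have : nth 0 p a \in p by rewrite mem_nth // -sz.
  by rewrite (perm_mem pp) mem_iota => /andP[].
have up a : a < size ks -> nth 0 s x < nth 0 s (nth 0 ks a).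
  by move=> ha; case: (hk (nth 0 ks a)) => //; rewrite mem_nth.
move=> [|a] [|b]; rewrite /= ?size_map ?ltnS => ha hb; rewrite ?ltnn //.
- by rewrite !(nth_map 0) -?sz // up // ltnS pos.
- rewrite !(nth_map 0) -?sz //; have := up _ ha; have := pos _ ha; lia.
- by rewrite o // !(nth_map 0 0) -?sz.
Qed.

(** * Independent sets as disjoint fillings *)

Definition disjoint_filling n (f : filling n) : Prop :=
  forall c d, f c <> [::] -> f d <> [::] ->
  cell_row c <= cell_col d -> cell_row d <= cell_col c -> c = d.

Lemma disjoint_fillingP n (f : filling n) :
  disjoint_filling f <->
  (forall c d, f c <> [::] -> f d <> [::] -> ~~ UDRC c d).
Proof.
split=> h c d fc fd.
  rewrite UDRCE; apply/negP => /and3P[/eqP cd h1 h2].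
  exact/cd/h.
move=> h1 h2; have := h c d fc fd; rewrite UDRCE h1 h2 !andbT negbK.
by move/eqP.
Qed.

Lemma cell_eqP n (c d : cell n) :
  cell_row c = cell_row d :> nat -> cell_col c = cell_col d :> nat -> c = d.
Proof.
case: c d => [[a b] h] [[a' b'] h'] /= /val_inj e1 /val_inj e2.
by apply: val_inj; rewrite /= [a]e1 [b]e2.
Qed.

Lemma SE_neq_nil n (s : seq nat) (c : cell n) :
  uniq s -> size (lrmin_positions s) = n ->
  SE n s c <> [::] <->
  exists k, k \in cell_positions s (cell_row c) (cell_col c).
Proof.
move=> us sn; rewrite SE_cell_word // /standardization /cell_word.
case: (cell_positions _ _ _) => [|k ks]; split=> //.
- by case.
- by exists k; rewrite inE eqxx.
Qed.

Lemma disjoint_SE n (s : seq nat) :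
  uniq s -> size (lrmin_positions s) = n ->
  disjoint_filling (SE n s) <-> disjoint_cells s.
Proof.
move=> us sn; split=> [h k l ks ls mk ml h1 h2 | h c d].
  have [c [rc cc]] := cell_exists sn ks; have [d [rd cd]] := cell_exists sn ls.
  have e : c = d.
    apply: h; rewrite ?rc ?cc ?rd ?cd // SE_neq_nil //; [exists k|exists l].
      by rewrite mem_cell_positions mk rc cc !eqxx.
    by rewrite mem_cell_positions ml rd cd !eqxx.
  by split; [rewrite -rc -rd e|rewrite -cc -cd e].
rewrite !SE_neq_nil // => -[k hk] [l hl].
move: hk hl; rewrite !mem_cell_positions.
case/and4P=> mk /eqP rk /eqP ck ks /and4P[ml /eqP rl /eqP cl ls] h1 h2.
have [||e1 e2] := h k l ks ls mk ml; first by rewrite rk cl.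
  by rewrite rl ck.
by apply: cell_eqP; rewrite -?rk -?rl -?ck -?cl.
Qed.

(** * Reconstruction of a word from its filling *)

(* A point (r, c, x) stands for the c-th left-to-right minimum if x = 0, in
   which case r = c, and for the entry x of the cell (r, c) otherwise. *)
Definition column_points n (f : filling n) (j : nat) : seq (nat * nat * nat) :=
  if [pick c : cell n | (cell_col c == j :> nat) && (f c != [::])] is Some c
  then [seq (val (cell_row c), j, x) | x <- f c] else [::].

(** Points are listed by position: each column opens with its minimum, followed by the only cell
    that a disjoint filling can occupy there. *)
Definition points n (f : filling n) : seq (nat * nat * nat) :=
  flatten [seq (j, j, 0) :: column_points f j | j <- iota 0 n].

(* The factor exceeds every height, so points compare by row, then by height. *)
Definition point_value n (f : filling n) (p : nat * nat * nat) : nat :=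
  (n - p.1.1) * (\sum_c size (f c)).+1 + p.2.

Definition point_word n (f : filling n) := map (point_value f) (points f).

Lemma point_value_lt n (f : filling n) p q :
  p.1.1 < n -> q.1.1 < n ->
  p.2 <= \sum_c size (f c) -> q.2 <= \sum_c size (f c) ->
  (point_value f p < point_value f q) =
  (q.1.1 < p.1.1) || (p.1.1 == q.1.1) && (p.2 < q.2).
Proof.
rewrite /point_value; move: (\sum_c _) => K.
case: p q => [[r c] x] [[r' c'] x'] /= rn rn' xK xK'.
case: (ltngtP r' r) => [h|h|->] /=; last by rewrite ltn_add2l.
  have -> : n - r' = n - r + (r - r') by lia.
  rewrite mulnDl -addnA ltn_add2l; have : 0 < r - r' by lia.
  by case: (r - r') => // d _; rewrite mulSn; lia.
have -> : n - r = n - r' + (r' - r) by lia.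
rewrite mulnDl -addnA ltn_add2l; have : 0 < r' - r by lia.
by case: (r' - r) => // d _; rewrite mulSn; lia.
Qed.

Lemma size_filling_le n (f : filling n) c : size (f c) <= \sum_c size (f c).
Proof. by rewrite (bigD1 c) //= leq_addr. Qed.

(** Used to cut the positions of a word into columns: along a weakly increasing key the fibres are
    consecutive blocks. *)
Lemma flatten_filter_key (T : eqType) (g : T -> nat) (l : seq T) m :
  pairwise (fun x y => g x <= g y) l ->
  flatten [seq [seq x <- l | g x == j] | j <- iota 0 m] =
  [seq x <- l | g x < m].
Proof.
move=> srt; elim: m => [|m IH].
  by rewrite (eq_filter (a2 := pred0)) ?filter_pred0.
rewrite -addn1 iotaD map_cat flatten_cat IH /= cats0 add0n addn1 {IH}.
elim: l srt => //= x l IH /andP[/allP xl /IH{}IH].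
have nil m' : m' <= g x -> [seq y <- l | g y < m'] = [::].
  move=> mx; apply/eqP; rewrite -[_ == _]negbK -has_filter; apply/hasPn => y.
  by move/xl; lia.
case: (ltngtP (g x) m) => h.
- by rewrite ltnS ltnW //= IH.
- by rewrite ltnS leqNgt h /= IH.
- by rewrite h ltnS leqnn -IH nil ?h.
Qed.

(** The point that represents position [k]. The height is the rank inside the cell, which is
    positive, so 0 is free to mark minima. *)
Definition decorate (s : seq nat) (k : nat) : nat * nat * nat :=
  (row_index s k, col_index s k,
   if is_lrmin s k then 0
   else count (leq^~ (nth 0 s k)) (cell_word s (row_index s k) (col_index s k))).

(** Both sides are compared column by column. *)
Lemma points_SE n (s : seq nat) :
  uniq s -> size (lrmin_positions s) = n -> disjoint_cells s ->
  points (SE n s) = [seq decorate s k | k <- iota 0 (size s)].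
Proof.
move=> us sn dis.
have e : flatten [seq [seq k <- iota 0 (size s) | col_index s k == j]
                    | j <- iota 0 n] = iota 0 (size s).
  rewrite flatten_filter_key; last first.
    apply: (@sub_in_pairwise _ (mem (iota 0 (size s))) ltn); last first.
    - by rewrite -(sorted_pairwise ltn_trans); apply: iota_ltn_sorted.
    - exact/allP.
    move=> x y; rewrite !mem_iota /= !add0n => xs ys xy.
    by apply: leq_col_index => //; apply: ltnW.
  apply/all_filterP/allP => k; rewrite mem_iota /= add0n => ks.
  by rewrite -sn col_index_lt.
rewrite -{}[in RHS]e map_flatten -map_comp /points; congr flatten.
apply/eq_in_map => j; rewrite mem_iota /= add0n => jn.
have jn' : j < size (lrmin_positions s) by rewrite sn.
have [mj js] := lrmin_pos_mem jn'.
(* A column is its opening minimum followed by its non-minima. *)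
have -> : [seq k <- iota 0 (size s) | col_index s k == j] =
    lrmin_pos s j :: [seq k <- iota 0 (size s)
                        | ~~ is_lrmin s k && (col_index s k == j)].
  apply: (irr_sorted_eq ltn_trans ltnn).
  - exact/(sorted_filter ltn_trans)/iota_ltn_sorted.
  - rewrite (sorted_pairwise ltn_trans) pairwise_cons.
    rewrite -(sorted_pairwise ltn_trans).
    rewrite (sorted_filter ltn_trans) ?iota_ltn_sorted // andbT.
    apply/allP => k; rewrite mem_filter mem_iota add0n => /and3P[/andP[mk cj] _ ks].
    by rewrite /= lrmin_pos_lt_nonmin // (eqP cj).
  move=> k; rewrite inE !mem_filter mem_iota /= add0n.
  case: (eqVneq k (lrmin_pos s j)) => [->|nk] /=.
    by rewrite col_index_lrmin_pos // eqxx.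
  case: (boolP (is_lrmin s k)) => //= mk.
  apply/negbTE/negP => /andP[/eqP cj ks]; case/eqP: nk.
  by rewrite -cj lrmin_pos_col_index.
rewrite /= {1}/decorate mj row_index_lrmin_pos // col_index_lrmin_pos //.
congr (_ :: _); rewrite /column_points; case: pickP => [c|none].
  case/andP=> /eqP cj /eqP /SE_neq_nil-/(_ us sn)[k0].
  rewrite mem_cell_positions => /and4P[m0 /eqP r0 /eqP c0 k0s].
  (* Cells of one column have intervals with the same right end, so disjointness puts every
     non-minimum of column [j] in the chosen cell. *)
  have -> : [seq k <- iota 0 (size s) | ~~ is_lrmin s k && (col_index s k == j)]
            = cell_positions s (cell_row c) (cell_col c).
    apply: eq_in_filter => k; rewrite mem_iota /= add0n => ks.
    case: (boolP (is_lrmin s k)) => //= mk; rewrite cj.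
    case: (eqVneq (col_index s k) j) => [ck|]; last by rewrite andbF.
    have [||<- _] := dis k0 k k0s ks m0 mk; last by rewrite r0 eqxx.
      by rewrite ck -cj -c0 leq_row_index_col_index.
    by rewrite c0 cj -ck leq_row_index_col_index.
  rewrite SE_cell_word // /standardization -!map_comp.
  apply/eq_in_map => k; rewrite mem_cell_positions.
  case/and4P=> mk /eqP rk /eqP ck ks.
  by rewrite /= /decorate (negbTE mk) rk ck cj.
(* With no cell chosen, a non-minimum in the column would make its own cell non-empty. *)
case E : [seq _ <- _ | _] => [|k ks] //=.
have : k \in [seq k <- iota 0 (size s) | ~~ is_lrmin s k && (col_index s k == j)].
  by rewrite E inE eqxx.
rewrite mem_filter mem_iota /= add0n => /andP[/andP[mk /eqP ck] ksz].
have [c [hr hc]] := cell_exists sn ksz; have := none c.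
rewrite hc ck eqxx /= => /negbFE/eqP h; have [_ []] := SE_neq_nil c us sn => //.
by exists k; rewrite mem_cell_positions mk hr hc !eqxx.
Qed.

(** Entries compare first by row, a larger index meaning smaller values. Within a row the minimum
    comes lowest and the non-minima share one cell, where ranks preserve the order. *)
Lemma point_word_SE n (s : seq nat) :
  uniq s -> size (lrmin_positions s) = n -> disjoint_cells s ->
  same_relative_order s (point_word (SE n s)).
Proof.
move=> us sn dis; rewrite /point_word points_SE // -map_comp.
rewrite -{1}[s](mkseq_nth 0); apply: same_relative_order_map => k l.
rewrite !mem_iota /= !add0n => ks ls.
have bnd k' : k' < size s -> (decorate s k').2 <= \sum_c size (SE n s c).
  move=> ks'; rewrite /decorate /=; case: ifP => // _.
  have [c [rc cc]] := cell_exists sn ks'; rewrite -rc -cc.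
  apply: leq_trans (size_filling_le _ c); rewrite SE_cell_word // size_map.
  exact: count_size.
have mono a b : a < size s -> b < size s -> nth 0 s a < nth 0 s b ->
    point_value (SE n s) (decorate s a) < point_value (SE n s) (decorate s b).
  move=> as_ bs ab.
  have rn k' : k' < size s -> (decorate s k').1.1 < n.
    by rewrite /= -sn; apply: row_index_lt.
  rewrite point_value_lt ?bnd ?rn //.
  have := leq_row_index as_ bs (ltnW ab); rewrite leq_eqVlt => /orP[/eqP r|]; last first.
    by move=> h; apply/orP; left.
  apply/orP; right; rewrite {1 2}/decorate /= r eqxx /=.
  (* The minimum of a row is its smallest entry, so the larger of two entries in a row is not a
     minimum. *)
  have mb : ~~ is_lrmin s b.
    apply/negP => mb; have := lrmin_pos_col_index bs mb.
    rewrite -row_index_lrmin // r => e.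
    have := leq_lrmin_val a (row_index_lt as_).
    by rewrite leqnn /lrmin_val e; lia.
  rewrite (negbTE mb).
  have bin : nth 0 s b \in cell_word s (row_index s a) (col_index s b).
    by apply: map_f; rewrite mem_cell_positions mb r !eqxx.
  case: ifP => [_|/negbT ma].
    by rewrite -has_count; apply/hasP; exists (nth 0 s b).
  have [||_ c] := dis a b as_ bs ma mb.
  - by rewrite -r leq_row_index_col_index.
  - by rewrite r leq_row_index_col_index.
  by rewrite c count_leq_mono.
(* Strict monotonicity suffices: the reversed case is symmetric, and equal entries have equal
   positions. *)
case: (ltngtP (nth 0 s k) (nth 0 s l)) => [h|h|/eqP].
- by rewrite mono.
- by have := mono _ _ ls ks h; rewrite /=; lia.
- by rewrite nth_uniq // => /eqP ->; rewrite ltnn.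
Qed.

(** A permutation is its own standardization, hence determined by its relative order, which
    [point_word] recovers from the filling. *)
Lemma SE_inj n (s t : seq nat) :
  is_permutation s -> is_permutation t ->
  size (lrmin_positions s) = n -> size (lrmin_positions t) = n ->
  disjoint_cells s -> disjoint_cells t -> SE n s = SE n t -> s = t.
Proof.
move=> ps pt sn tn ds dt e.
rewrite -(standardization_id ps) -(standardization_id pt).
rewrite (standardization_ext (point_word_SE (permutation_uniq ps) sn ds)) e.
by rewrite (standardization_ext (point_word_SE (permutation_uniq pt) tn dt)).
Qed.

(** * Invariance of the encoding under relative order *)

Lemma same_relative_order_lrmin (s t : seq nat) k :
  same_relative_order s t -> k < size s -> is_lrmin s k = is_lrmin t k.
Proof.
case=> sz o ks; rewrite !is_lrminE -?sz ?(ltnW ks) //.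
apply: eq_in_all => i; rewrite mem_iota /= add0n => ik.
by rewrite o // (ltn_trans ik).
Qed.

Lemma same_relative_order_lrmin_positions (s t : seq nat) :
  same_relative_order s t -> lrmin_positions s = lrmin_positions t.
Proof.
move=> o; rewrite /lrmin_positions -(o.1); apply: eq_in_filter => k.
by rewrite mem_iota /= add0n; apply: same_relative_order_lrmin.
Qed.

Lemma same_relative_order_SE n (s t : seq nat) :
  uniq s -> uniq t -> size (lrmin_positions s) = n ->
  same_relative_order s t -> SE n s = SE n t.
Proof.
move=> us ut sn o; have e := same_relative_order_lrmin_positions o.
have pe r c : cell_positions s r c = cell_positions t r c.
  rewrite /cell_positions -(o.1); apply: eq_in_filter => k.
  rewrite mem_iota /= add0n => ks.
  rewrite -(same_relative_order_lrmin o ks) /col_index e.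
  suff -> : row_index s k = row_index t k by [].
  rewrite /row_index -e; apply: eq_in_count => p.
  by rewrite mem_lrmin_positions => /andP[_ ps]; apply: o.2.
apply/ffunP => c; rewrite !SE_cell_word -?e // /cell_word -pe.
apply/standardization_ext/same_relative_order_nth => // k.
by rewrite mem_filter => /andP[].
Qed.

Lemma flatten_map_single (T U : eqType) (F : T -> seq U) (r : seq T) x :
  uniq r -> x \in r -> (forall y, y \in r -> y != x -> F y = [::]) ->
  flatten [seq F y | y <- r] = F x.
Proof.
elim: r => //= y r IH /andP[yr ur]; rewrite inE => /orP[/eqP -> | xr] h.
  have -> : flatten [seq F z | z <- r] = [::].
    have : forall z, z \in r -> F z = [::].
      move=> z zr; apply: h; first by rewrite inE zr orbT.
      by apply: contraNneq yr => <-.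
    elim: (r) => //= z s IHs hz; rewrite hz ?inE ?eqxx // IHs // => w ws.
    by rewrite hz // inE ws orbT.
  by rewrite cats0.
rewrite h ?inE ?eqxx //; last by apply: contraNneq yr => ->.
by apply: IH => // z zr; apply: h; rewrite inE zr orbT.
Qed.

(** * The word built from a disjoint filling *)

Section Reconstruction.
Variables (n : nat) (f : filling n).
Hypothesis dis : disjoint_filling f.
Hypothesis perm : forall c, is_permutation (f c).

Lemma filling_pos c x : x \in f c -> 0 < x.
Proof. by rewrite (perm_mem (perm c)) mem_iota => /andP[]. Qed.

Lemma filling_le c x : x \in f c -> x <= \sum_c size (f c).
Proof.
rewrite (perm_mem (perm c)) mem_iota => /andP[_].
by rewrite add1n ltnS => h; apply: leq_trans h (size_filling_le _ _).
Qed.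

Lemma mem_column_points j (p : nat * nat * nat) :
  p \in column_points f j ->
  exists c, [/\ cell_row c = p.1.1 :> nat, cell_col c = p.1.2 :> nat,
                p.1.2 = j & p.2 \in f c].
Proof.
rewrite /column_points; case: pickP => // c /andP[/eqP cj _] /mapP[x xf ->].
by exists c.
Qed.

Lemma mem_points (p : nat * nat * nat) :
  p \in points f ->
  [/\ p.1.1 <= p.1.2, p.1.2 < n, p.2 <= \sum_c size (f c) &
      (p.2 = 0 /\ p.1.1 = p.1.2) \/
      (0 < p.2 /\ exists c, [/\ cell_row c = p.1.1 :> nat,
                                cell_col c = p.1.2 :> nat & p.2 \in f c])].
Proof.
case/flatten_mapP=> j; rewrite mem_iota /= add0n => jn.
rewrite inE => /orP[/eqP ->|/mem_column_points[c [rc cc cj xc]]].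
  by split=> //; left.
split; rewrite ?cj //.
- by rewrite -rc -cj -cc; exact: (valP c).
- exact: filling_le xc.
by right; split; [exact: filling_pos xc|exists c; rewrite -cj].
Qed.

Lemma lrmin_points j : j < n -> (j, j, 0) \in points f.
Proof.
move=> jn; apply/flatten_mapP; exists j; first by rewrite mem_iota.
by rewrite inE eqxx.
Qed.

(** What is kept of the listing order: columns increase, and a minimum comes first in its column.
    Inside a cell only distinctness of heights is recorded, since their order there is arbitrary. *)
Definition precedes (p q : nat * nat * nat) : bool :=
  (p.1.2 < q.1.2) || [&& p.1.2 == q.1.2, p.2 != q.2 & 0 < q.2].

Lemma points_pairwise : pairwise precedes (points f).
Proof.
(* Generalized to the first [m] columns for induction. *)
suff H m : m <= n -> pairwise precedes
    (flatten [seq (j, j, 0) :: column_points f j | j <- iota 0 m]) by exact: H.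
elim: m => // m IH mn; rewrite -addn1 iotaD map_cat flatten_cat add0n /= cats0.
have colm q : q \in column_points f m -> q.1.2 = m /\ 0 < q.2.
  by case/mem_column_points=> c [_ _ -> /filling_pos].
rewrite pairwise_cat IH ?(ltnW mn) //=; apply/and3P; split.
- apply/allrelP => p q /flatten_mapP[j]; rewrite mem_iota add0n /= => jm hp hq.
  rewrite /precedes; have -> : q.1.2 = m.
    by move: hq; rewrite inE => /orP[/eqP ->|/colm[]].
  suff -> : p.1.2 = j by rewrite jm.
  by move: hp; rewrite inE => /orP[/eqP ->|/mem_column_points[c []]].
- apply/allP => q /colm[e q0]; rewrite /precedes /= e eqxx q0 ltnn /=.
  by rewrite andbT; case: (q.2) q0.
rewrite /column_points; case: pickP => // c _.
rewrite pairwise_map; have := permutation_uniq (perm c).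
rewrite uniq_pairwise; apply: (@sub_in_pairwise _ (mem (f c))); last exact/allP.
move=> x y /= _ /filling_pos y0 xy.
by rewrite /precedes /= ltnn eqxx xy y0.
Qed.

Local Notation pt k := (nth (0, 0, 0) (points f) k).

Lemma nth_points k :
  k < size (points f) ->
  [/\ (pt k).1.1 <= (pt k).1.2, (pt k).1.2 < n,
      (pt k).2 <= \sum_c size (f c) &
      ((pt k).2 = 0 /\ (pt k).1.1 = (pt k).1.2) \/
      (0 < (pt k).2 /\ exists c, [/\ cell_row c = (pt k).1.1 :> nat,
                     cell_col c = (pt k).1.2 :> nat & (pt k).2 \in f c])].
Proof. by move=> ks; apply: mem_points; apply: mem_nth. Qed.

Lemma points_precedes a b :
  a < b -> b < size (points f) -> precedes (pt a) (pt b).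
Proof.
move=> ab bs; apply: (pairwiseP _ points_pairwise) => //.
by rewrite inE (ltn_trans ab).
Qed.

Lemma nth_point_word k :
  k < size (points f) -> nth 0 (point_word f) k = point_value f (pt k).
Proof. by move=> ks; rewrite (nth_map (0, 0, 0)). Qed.

Lemma point_word_lt a b :
  a < size (points f) -> b < size (points f) ->
  (nth 0 (point_word f) a < nth 0 (point_word f) b) =
  ((pt b).1.1 < (pt a).1.1) ||
  ((pt a).1.1 == (pt b).1.1) && ((pt a).2 < (pt b).2).
Proof.
move=> ha hb; rewrite !nth_point_word //.
have [] := nth_points ha => h1 h2 h3 _.
have [] := nth_points hb => h4 h5 h6 _.
by rewrite point_value_lt // ?(leq_ltn_trans h1) ?(leq_ltn_trans h4).
Qed.

(** Equal values force equal rows and heights. The columns then agree too, trivially for minima and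
    by disjointness for cell entries, whereas heights within a column are distinct. *)
Lemma point_word_uniq : uniq (point_word f).
Proof.
apply/(uniqP 0) => a b; rewrite !inE size_map.
wlog ab : a b / a < b.
  move=> W ha hb e; case: (ltngtP a b) => // h; first exact: W.
  by apply/esym/W.
move=> ha hb e; have := point_word_lt ha hb; rewrite e ltnn.
have := point_word_lt hb ha; rewrite e ltnn => e1 e2.
have r : (pt a).1.1 = (pt b).1.1 by lia.
have x : (pt a).2 = (pt b).2 by move: e1 e2; rewrite r eqxx /=; lia.
have [h1 h2 h3 h4] := nth_points ha.
have [h5 h6 h7 h8] := nth_points hb.
suff c : (pt a).1.2 = (pt b).1.2.
  by have := points_precedes ab hb; rewrite /precedes c x !eqxx ltnn.
case: h4 h8 => [[xa ea]|[xa [c [rc cc xc]]]] [[xb eb]|[xb [d [rd cd xd]]]].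
- by rewrite -ea -eb.
- by lia.
- by lia.
have -> : (pt a).1.2 = cell_col c by [].
rewrite (_ : c = d) //; apply: dis.
- by move=> e'; rewrite e' in xc.
- by move=> e'; rewrite e' in xd.
- by rewrite rc cd r.
- by rewrite rd cc -r.
Qed.

(** A point of positive height comes after the minimum of its column, which is smaller. A point of
    height 0 in column [j] comes after points of earlier columns only; their rows are less than [j],
    so their values are larger. *)
Lemma point_word_lrmin k :
  k < size (points f) -> is_lrmin (point_word f) k = ((pt k).2 == 0).
Proof.
move=> ks; rewrite is_lrminE ?size_map ?(ltnW ks) //.
have [h1 h2 h3 h4] := nth_points ks.
apply/idP/eqP => [|x0].
  case: h4 => [[]|[x0 _]] //; move/allP=> h; exfalso.
  pose m := ((pt k).1.2, (pt k).1.2, 0); have mp := lrmin_points h2.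
  pose l := index m (points f).
  have ls : l < size (points f) by rewrite index_mem.
  have el : pt l = m by rewrite nth_index.
  have lk : l < k.
    rewrite ltnNge leq_eqVlt; apply/negP => /orP[/eqP e|kl].
      by move: x0; rewrite e el.
    by have := points_precedes kl ls; rewrite /precedes el /= ltnn !andbF.
  have := h l; rewrite mem_iota /= add0n => /(_ lk).
  by rewrite point_word_lt // el /=; lia.
apply/allP => l; rewrite mem_iota /= add0n => lk; have ls := ltn_trans lk ks.
rewrite point_word_lt //; case: h4 => [[_ e]|[]]; last by rewrite x0.
have := points_precedes lk ks; rewrite /precedes x0 !andbF orbF => cl.
have [h5 _ _ _] := nth_points ls.
by apply/orP; left; rewrite e; apply: leq_ltn_trans cl.
Qed.

Lemma map_nth_filter_points (a : pred (nat * nat * nat)) :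
  [seq pt k | k <- iota 0 (size (points f)) & a (pt k)] =
  [seq p <- points f | a p].
Proof.
by rewrite -[in RHS](mkseq_nth (0, 0, 0) (points f)) /mkseq filter_map.
Qed.

(** Each column block contributes exactly its head, which identifies the [j]-th minimum of the word
    with the point [(j, j, 0)]. *)
Lemma points_lrmin_positions :
  [seq pt k | k <- lrmin_positions (point_word f)] =
  [seq (j, j, 0) | j <- iota 0 n].
Proof.
transitivity [seq p <- points f | p.2 == 0].
  rewrite -(map_nth_filter_points (fun p => p.2 == 0)); congr map.
  rewrite /lrmin_positions size_map; apply: eq_in_filter => k.
  by rewrite mem_iota /= add0n => ks; rewrite point_word_lrmin.
rewrite filter_flatten -map_comp -[RHS]flatten_map1; congr flatten.
apply/eq_in_map => j _ /=; congr (_ :: _).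
apply/eqP; rewrite -[_ == _]negbK -has_filter; apply/hasPn => p.
by case/mem_column_points=> c [_ _ _ /filling_pos]; lia.
Qed.

Lemma size_point_word_lrmin : size (lrmin_positions (point_word f)) = n.
Proof.
by rewrite -(size_map (fun k => pt k)) points_lrmin_positions size_map size_iota.
Qed.

Lemma pt_lrmin_pos j : j < n -> pt (lrmin_pos (point_word f) j) = (j, j, 0).
Proof.
move=> jn; rewrite -(nth_map 0 (0, 0, 0) (fun k => pt k)) ?size_point_word_lrmin //.
by rewrite points_lrmin_positions (nth_map 0) ?size_iota // nth_iota.
Qed.

(** An index less than [n] is determined by the [j < n] that it bounds, and these are found by
    comparing position [k] with that of the point [(j, j, 0)]. *)
Lemma point_word_col_index k :
  k < size (points f) -> col_index (point_word f) k = (pt k).1.2.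
Proof.
move=> ks; have ku : k < size (point_word f) by rewrite size_map.
have [_ h2 _ _] := nth_points ks.
have h j : j < n -> (j <= col_index (point_word f) k) = (j <= (pt k).1.2).
  move=> jn; have jn' : j < size (lrmin_positions (point_word f)).
    by rewrite size_point_word_lrmin.
  rewrite -leq_lrmin_pos //; have [_] := lrmin_pos_mem jn'.
  rewrite size_map => ps; have ej := pt_lrmin_pos jn.
  case: (ltngtP (lrmin_pos (point_word f) j) k) => [lt|gt|e].
  - by have := points_precedes lt ks; rewrite /precedes ej /=; lia.
  - by have := points_precedes gt ps; rewrite /precedes ej /= !andbF; lia.
  - by rewrite -e ej leqnn.
have cn := col_index_lt ku; rewrite size_point_word_lrmin in cn.
apply/eqP; rewrite eqn_leq; have := h _ cn; have := h _ h2.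
by rewrite !leqnn => -> <-.
Qed.

Lemma point_word_row_index k :
  k < size (points f) -> row_index (point_word f) k = (pt k).1.1.
Proof.
move=> ks; have ku : k < size (point_word f) by rewrite size_map.
have [h1 h2 _ _] := nth_points ks.
have h j : j < n -> (row_index (point_word f) k <= j) = ((pt k).1.1 <= j).
  move=> jn; have jn' : j < size (lrmin_positions (point_word f)).
    by rewrite size_point_word_lrmin.
  rewrite -leq_lrmin_val //; have [_] := lrmin_pos_mem jn'.
  rewrite size_map => ps; have ej := pt_lrmin_pos jn.
  by rewrite leqNgt point_word_lt // ej /=; lia.
have rn := row_index_lt ku; rewrite size_point_word_lrmin in rn.
apply/eqP; rewrite eqn_leq; have := h _ rn; have := h _ (leq_ltn_trans h1 h2).
by rewrite !leqnn => -> <-.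
Qed.

Lemma points_cell (c : cell n) :
  [seq p <- points f
     | [&& p.2 != 0, p.1.1 == val (cell_row c) & p.1.2 == val (cell_col c)]]
  = [seq (val (cell_row c), val (cell_col c), x) | x <- f c].
Proof.
rewrite filter_flatten -map_comp.
rewrite (@flatten_map_single _ _ _ _ (val (cell_col c))) ?iota_uniq //=.
- rewrite /column_points; case: pickP => [d /andP[/eqP cd /eqP fd]|none].
    case: (eqVneq d c) => [->|dc].
      apply/all_filterP/allP => _ /mapP[x /filling_pos x0 ->] /=.
      by rewrite !eqxx !andbT; lia.
    have rdc : (cell_row d == cell_row c :> nat) = false.
      apply: contraNF dc => /eqP rdc; apply/eqP/cell_eqP => //.
    (* The column went to another cell [d], whose interval meets that of [c] at the common right
       end, so [c] must be empty. *)
    have -> : f c = [::].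
      case E : (f c) => [|x s] //; case/eqP: dc; apply: dis; rewrite ?E //.
        by rewrite -cd; exact: (valP d).
      by rewrite cd; exact: (valP c).
    apply/eqP; rewrite -[_ == _]negbK -has_filter; apply/hasPn => p.
    by case/mapP=> x _ -> /=; rewrite rdc andbF.
  by have := none c; rewrite eqxx /= => /negbFE/eqP ->.
- by rewrite mem_iota /= add0n ltn_ord.
move=> j _ jc; apply/eqP; rewrite -[_ == _]negbK -has_filter; apply/hasPn => p.
by case/mem_column_points=> d [_ _ -> _]; rewrite (negbTE jc) !andbF.
Qed.

Lemma SE_point_word : SE n (point_word f) = f.
Proof.
apply/ffunP => c; rewrite SE_cell_word ?point_word_uniq ?size_point_word_lrmin //.
rewrite -[RHS](standardization_id (perm c)); apply: standardization_ext.
have -> : cell_word (point_word f) (cell_row c) (cell_col c) =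
    [seq point_value f p | p <- points f
       & [&& p.2 != 0, p.1.1 == val (cell_row c) & p.1.2 == val (cell_col c)]].
  rewrite -map_nth_filter_points -map_comp /cell_word.
  rewrite (_ : cell_positions _ _ _ =
    [seq k <- iota 0 (size (points f)) | [&& (pt k).2 != 0,
       (pt k).1.1 == cell_row c & (pt k).1.2 == cell_col c]]).
    apply/eq_in_map => k; rewrite mem_filter mem_iota add0n => /and3P[_ _ ks].
    by rewrite nth_point_word.
  rewrite /cell_positions size_map; apply: eq_in_filter => k.
  rewrite mem_iota /= add0n => ks.
  by rewrite point_word_lrmin // point_word_row_index // point_word_col_index.
rewrite points_cell -map_comp -[f c in X in same_relative_order _ X]map_id.
(* Within a cell the row is fixed, so values are heights plus a constant. *)
by apply: same_relative_order_map => x y _ _; rewrite /= /point_value ltn_add2l.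
Qed.

(** [point_word] need not be a permutation; its standardization is one and has the same encoding. *)
Lemma SE_surj :
  exists s, [/\ is_permutation s, size (lrmin_positions s) = n & SE n s = f].
Proof.
have u := point_word_uniq; have o := standardization_order (point_word f).
have p := standardization_permutation u.
exists (standardization (point_word f)); split=> //.
  by rewrite -(same_relative_order_lrmin_positions o) size_point_word_lrmin.
rewrite -(same_relative_order_SE u (permutation_uniq p) _ o) ?SE_point_word //.
exact: size_point_word_lrmin.
Qed.

End Reconstruction.

(** * Assembling the bijection *)

Lemma avoids_basis4P (s : seq nat) :
  avoids_basis4 s <->
  forall q, [set [:: 2; 4; 1; 3]; [:: 3; 1; 4; 2];
                 [:: 2; 3; 1; 4]; [:: 3; 1; 2; 4]]%classic q -> ~ contains s q.
Proof.
split=> [[h1 h2 h3 h4] q [[[->|->]|->]|->] // | h].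
by split; apply: h; [do 3 left|do 2 left; right|left; right|right].
Qed.

Local Open Scope classical_set_scope.

Theorem theorem5p3 (P : set (seq nat)) (n : nat)
  (hP : forall p, P p -> is_permutation p /\ p <> [::]) :
  set_bij
    (Av_lrmin n ([set [:: 2; 4; 1; 3]; [:: 3; 1; 4; 2];
                      [:: 2; 3; 1; 4]; [:: 3; 1; 2; 4]] `|` oplus1 @` P))
    (WI (@UDRC n)
        (Avplus ([set [:: 2; 4; 1; 3]; [:: 3; 1; 4; 2];
                      [:: 2; 3; 1; 4]; [:: 3; 1; 2; 4]] `|` P)))
    (@SE n).
Proof.
have dom s Q : Av_lrmin n ([set [:: 2; 4; 1; 3]; [:: 3; 1; 4; 2];
      [:: 2; 3; 1; 4]; [:: 3; 1; 2; 4]] `|` Q) s ->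
    [/\ is_permutation s, size (lrmin_positions s) = n, avoids_basis4 s,
        disjoint_cells s & forall q, Q q -> ~ contains s q].
  case=> [[ps av] sn]; have b : avoids_basis4 s.
    by apply/avoids_basis4P => q hq; apply: av; left.
  split=> //; first exact: avoids_basis4_disjoint (permutation_uniq ps) b.
  by move=> q hq; apply: av; right.
split.
- move=> s /dom[ps sn b d av]; have us := permutation_uniq ps; split.
    exact/disjoint_fillingP/disjoint_SE.
  move=> c ne; split=> //; split.
    rewrite SE_cell_word //; apply: standardization_permutation.
    exact: subseq_uniq (cell_word_subseq _ _ _) us.
  move=> q [hq|hq].
    have /avoids_basis4P/(_ q hq) nq := b; move=> h; apply: nq.
    apply: contains_subseq (cell_word_subseq s (cell_row c) (cell_col c)) _.
    apply/(contains_order_iff _ (standardization_order _)).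
    by rewrite -SE_cell_word.
  apply: SE_avoids_of_oplus1 => //; first by case: (hP q hq).
  by apply: av; exists q.
- move=> s t /set_mem/dom[ps sn _ ds _] /set_mem/dom[pt tn _ dt _].
  exact: SE_inj.
- move=> f [ind fS]; have d : disjoint_filling f by apply/disjoint_fillingP.
  (* The empty word counts as a permutation, which covers the empty cells. *)
  have pf c : is_permutation (f c).
    case E : (f c) => [|x l] //; rewrite -E.
    by have [|[]] := fS c; rewrite ?E.
  have [s [ps sn sf]] := SE_surj d pf; have us := permutation_uniq ps.
  have ds : disjoint_cells s by apply/(disjoint_SE us sn); rewrite sf.
  exists s => //; split=> //; split=> // q [hq|[p hp <-]].
    move: q hq; apply/avoids_basis4P/(disjoint_avoids_basis4 us sn ds) => c.
    rewrite sf => /fS[[_ av] _]; apply/avoids_basis4P => q hq.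
    by apply: av; left.
  have [pp p0] := hP p hp; apply: (disjoint_avoids_oplus1 us sn ds pp p0) => c.
  by rewrite sf => /fS[[_ av] _]; apply: av; right.
Qed.
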